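(* Let $q>0$ be real. The $q$-th power of Lebesgue measure $1\,dt$ on $[0,1]$ is the measure $$f(u)\,du=\frac1{\Gamma(q)}(-\ln u)^{q-1}\,du\quad\text{on }[0,1].$$ Alternatively stated: the Berger measure of the weighted shift whose moment sequence is $\left(\left(\frac1{n+1}\right)^q\right)_{n=0}^\infty$ is $\frac1{\Gamma(q)}(-\ln u)^{q-1}\,du$ on $[0,1]$.
   Context: $\Gamma$ is the classical Gamma function. The $q$-th power of a probability measure $\mu$ with compact support in $[0,\infty)$ is the (unique, if it exists) compactly supported positive measure $\mu_q$ on $[0,\infty)$ with $\int t^n\,d\mu_q(t)=\left(\int t^n\,d\mu(t)\right)^q$ for all integers $n\ge0$. For a bounded sequence $\alpha=(\alpha_n)_{n\ge0}$ of positive numbers, the weighted shift $W_\alpha$ on $\ell^2$ is $W_\alpha e_n=\alpha_ne_{n+1}$; its moments are $\gamma_0=1$, $\gamma_n=\prod_{i=0}^{n-1}\alpha_i^2$ for $n\ge1$; a Berger measure of $W_\alpha$ is a probability measure $\mu$ on $[0,\|W_\alpha\|^2]$ with $\gamma_n=\int t^n\,d\mu(t)$ for all $n\ge0$. *)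

(* Defs.v *)
From HB Require Import structures.
From mathcomp Require Import all_boot all_order all_algebra.
From mathcomp Require Import all_classical all_reals all_analysis.
From mathcomp Require Import measurable_realfun.
From mathcomp Require Import complex.

Set Implicit Arguments.
Unset Strict Implicit.
Unset Printing Implicit Defensive.

Import Order.TTheory GRing.Theory Num.Theory.
Import numFieldNormedType.Exports.

Local Open Scope classical_set_scope.
Local Open Scope ring_scope.

(* Meaningful for 0 < q, where the integrand is integrable; the value of
   t `^ (q - 1) * expR (- t) at the single point t = 0 is immaterial. *)
Definition Gamma {R : realType} (q : R) : R :=
  \int[lebesgue_measure]_(t in `[0, +oo[) (t `^ (q - 1) * expR (- t)).

(* Measures on [0, +oo[ are represented as Borel measures on R; being
   concentrated on a subset of [0, +oo[ is always a separate hypothesis. *)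
Notation borel_measure R := (measure (measurableTypeR R) R).

Section Measures.
Context {R : realType}.
Implicit Types (q : R) (mu nu : borel_measure R).

(* The underlying functions are total on set R, so that measures can only be
   compared on measurable sets. *)
Definition same_measure mu nu :=
  forall A : set (measurableTypeR R), measurable A -> mu A = nu A.

Definition compactly_supported mu :=
  exists K : set R, [/\ compact K, K `<=` `[0, +oo[ & mu (~` K) = 0%E].

Definition moment mu (n : nat) : \bar R :=
  (\int[mu]_(t in `[0%R, +oo[) (t ^+ n)%:E)%E.

Definition is_power q (mu : probability (measurableTypeR R) R) nu :=
  [/\ compactly_supported mu, compactly_supported nu &
      forall n, moment nu n = (moment mu n `^ q)%E].

Definition is_the_power q (mu : probability (measurableTypeR R) R) nu :=
  is_power q mu nu /\ (forall nu', is_power q mu nu' -> same_measure nu' nu).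

End Measures.

Section Lebesgue01.
Context {R : realType}.

Definition lebesgue01 : set (measurableTypeR R) -> \bar R :=
  mrestr lebesgue_measure (measurable_itv `[0%R, 1%R]).

HB.instance Definition _ := Measure.on lebesgue01.

Let lebesgue01_setT : lebesgue01 setT = 1%E.
Proof.
by rewrite /lebesgue01 /mrestr setTI lebesgue_measure_itv/= lte_fin ltr01 sube0.
Qed.

HB.instance Definition _ :=
  @Measure_isProbability.Build _ _ R lebesgue01 lebesgue01_setT.

End Lebesgue01.

Section LogPower.
Context {R : realType}.
Variable q : R.

(* At u = 0 and u = 1 the value follows from the conventions for ln 0, 0 `^ 0
   and the division by zero; these two points form a Lebesgue-null set. *)
Definition log_density (u : R) : R := (Gamma q)^-1 * (- ln u) `^ (q - 1).

Definition log_measure (A : set (measurableTypeR R)) : \bar R :=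
  (\int[lebesgue_measure]_(u in A `&` `[0%R, 1%R]) (log_density u)%:E)%E.

Lemma log_density_ge0 u : 0 <= log_density u.
Proof.
rewrite mulr_ge0 ?powR_ge0// invr_ge0; apply: Rintegral_ge0 => t _.
by rewrite mulr_ge0 ?powR_ge0 ?expR_ge0.
Qed.

Lemma measurable_log_density : measurable_fun setT log_density.
Proof.
apply: measurable_funM => //.
apply: (measurableT_comp (measurable_powR _)).
by apply: measurableT_comp => //; exact: measurable_ln.
Qed.

Let log_measure0 : log_measure set0 = 0%E.
Proof. by rewrite /log_measure set0I integral_set0. Qed.

Let log_measure_ge0 A : (0 <= log_measure A)%E.
Proof. by apply: integral_ge0 => u _; rewrite lee_fin log_density_ge0. Qed.

Let log_measure_sigma_additive : semi_sigma_additive log_measure.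
Proof.
move=> /= F mF tF mUF; rewrite /log_measure setI_bigcupl; apply: cvg_toP.
  apply: ereal_nondecreasing_is_cvgn => m n mn.
  by apply: lee_sum_nneg_natr => // k _ _; exact: log_measure_ge0.
rewrite ge0_integral_bigcup//=.
- by move=> k; apply: measurableI => //; exact: measurable_itv.
- apply/measurable_funTS/measurableT_comp => //.
  exact: measurable_log_density.
- by move=> u _; rewrite lee_fin log_density_ge0.
- exact: trivIset_setIr.
Qed.

HB.instance Definition _ := isMeasure.Build _ _ _ log_measure
  log_measure0 log_measure_ge0 log_measure_sigma_additive.

End LogPower.

Section WeightedShift.
Context {R : realType}.
Implicit Types (alpha : nat -> R) (x : nat -> R[i]).
Local Open Scope ereal_scope.

Definition is_weight_sequence alpha :=
  (forall n, (0 < alpha n)%R) /\ (exists M : R, forall n, (alpha n <= M)%R).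

(* The complex Hilbert space l^2 consists of the x with l2norm x < +oo. *)
Definition l2norm x : \bar R :=
  'N[counting]_(2%:E) [(fun n => (complex.Re `|x n|)%:E)].

Definition weighted_shift alpha x : nat -> R[i] :=
  fun n => if n is m.+1 then ((alpha m)%:C%C * x m)%R else 0%R.

Definition shift_norm alpha : \bar R :=
  ereal_sup [set l2norm (weighted_shift alpha x) | x in [set x | l2norm x <= 1]].

Definition shift_moment alpha (n : nat) : R :=
  (\prod_(0 <= i < n) alpha i ^+ 2)%R.

Definition is_Berger alpha (mu : borel_measure R) :=
  [/\ mu setT = 1,
      mu (~` [set t : R | 0 <= t%:E <= shift_norm alpha ^+ 2]) = 0 &
      forall n, (shift_moment alpha n)%:E = moment mu n].

Definition is_the_Berger alpha (mu : borel_measure R) :=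
  is_Berger alpha mu /\ (forall nu, is_Berger alpha nu -> same_measure nu mu).

Lemma weighted_shift_basis alpha (n : nat) :
  weighted_shift alpha (fun k => ((k == n)%:R)%R) =
  (fun k => ((alpha n)%:C%C * (k == n.+1)%:R)%R).
Proof.
apply/funext => -[|k] /=; first by rewrite mulr0.
by rewrite eqSS; case: eqP => [->|]//; rewrite !mulr0.
Qed.

End WeightedShift.

(* Main.v *)
Require Import Defs.
From HB Require Import structures.
From mathcomp Require Import all_boot all_order all_algebra.
From mathcomp Require Import all_classical all_reals all_analysis.
From mathcomp Require Import measurable_realfun ring.
From mathcomp Require Import complex.

(* The substitution u = exp (- t / (n + 1)) turns the n-th moment of
   (- ln u)^(q - 1) du on [0, 1] into (n + 1)^-q Gamma(q).

   Uniqueness: if a measure on [0, +oo[ has bounded moments, then it is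
   concentrated on [0, 1], since (1 + h)^n mu [1 + h, +oo[ is at most the n-th
   moment.  A measure on [0, 1] is determined by its moments because, for
   0 < x <= 1, the polynomials (1 - t^n)^(N_n) with N_n ~ n x^-n converge boundedly
   on [0, 1] to the indicator function of [0, x[.

   The squared weights are ((n + 1) / (n + 2))^q; they tend to 1, so the norm of
   the shift is at least 1 and [0, 1] lies in [0, norm^2]. *)

Set Implicit Arguments.
Unset Strict Implicit.
Unset Printing Implicit Defensive.

Import Order.TTheory GRing.Theory Num.Theory.
Import numFieldNormedType.Exports.
Local Open Scope classical_set_scope.
Local Open Scope ring_scope.

(** * Integration against a measure given by a density *)

Section Density.
Local Open Scope ereal_scope.
Context d (T : measurableType d) (R : realType).
Variables (mu nu : {measure set T -> \bar R}) (g : T -> R).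
Hypotheses (mg : measurable_fun setT g) (g0 : forall x, (0 <= g x)%R).
Hypothesis nuE : forall A, measurable A -> nu A = \int[mu]_(x in A) (g x)%:E.

Import HBNNSimple.

(** Both sides are monotone limits along simple functions increasing to [f]; for a simple function
    the identity reduces to [nuE] on its level sets. *)
Lemma ge0_integral_density (D : set T) (f : T -> \bar R) : measurable D ->
  measurable_fun D f -> (forall x, D x -> 0 <= f x) ->
  \int[nu]_(x in D) f x = \int[mu]_(x in D) (f x * (g x)%:E).
Proof.
move=> mD mf f0.
pose f_ := nnsfun_approx mD mf.
have cvgf x : D x -> EFin \o f_^~ x @ \oo --> f x.
  by move=> Dx; exact: cvg_nnsfun_approx.
have ndf x m n : (m <= n)%N -> (f_ m x <= f_ n x)%R.
  by move=> mn; exact/lefP/nd_nnsfun_approx.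
have mgD : measurable_fun D (EFin \o g)
  by exact/measurable_EFinP/measurable_funTS.
have mfg n : measurable_fun D (fun x => (f_ n x)%:E * (g x)%:E).
  by apply: emeasurable_funM => //; exact/measurable_EFinP/measurable_funTS.
transitivity (limn (fun n => \int[nu]_(x in D) (f_ n x)%:E)).
  rewrite -monotone_convergence//.
  - by apply: eq_integral => x /[!inE] Dx; apply/esym/cvg_lim => //; exact: cvgf.
  - by move=> n; exact/measurable_EFinP/measurable_funTS.
  - by move=> n x _; rewrite lee_fin.
  - by move=> x _ m n mn; rewrite lee_fin ndf.
transitivity (limn (fun n => \int[mu]_(x in D) ((f_ n x)%:E * (g x)%:E))); last first.
  rewrite -monotone_convergence//.
  - apply: eq_integral => x /[!inE] Dx; apply/cvg_lim => //.
    by apply: cvgeZr => //; exact: cvgf.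
  - by move=> n x _; rewrite mule_ge0// lee_fin.
  - by move=> x _ m n mn; rewrite lee_wpmul2r ?lee_fin ?ndf//.
congr (limn _); apply/funext => n.
transitivity (\sum_(k \in range (f_ n)) (k%:E * nu ((f_ n @^-1` [set k]) `&` D))).
  under eq_integral do rewrite fimfunE -fsumEFin//.
  rewrite ge0_integral_fsum//; last 2 first.
  - by move=> y; exact/measurable_EFinP/measurable_funM.
  - by move=> y x _; rewrite nnfun_muleindic_ge0.
  by apply: eq_fsbigr => r _; rewrite integralZl_indic_nnsfun// integral_indic.
transitivity (\sum_(k \in range (f_ n)) 
    \int[mu]_(x in D) (k%:E * ((\1_(f_ n @^-1` [set k]) x)%:E * (g x)%:E))).
  apply: eq_fsbigr => r /[!inE] -[x _ fxr].
  (* The scalar is nonnegative because the sum runs over attained values only. *)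
  have r0 : (0 <= r)%R by rewrite -fxr.
  rewrite ge0_integralZl//; last 2 first.
  - by apply: emeasurable_funM => //; exact/measurable_EFinP.
  - by move=> y _; rewrite mule_ge0// lee_fin.
  rewrite nuE; last exact: measurableI.
  rewrite setIC integral_mkcondr; congr (_ * _); apply: eq_integral => y _.
  rewrite patchE indicE; case: ifPn => _; first by rewrite mul1e.
  by rewrite mul0e.
rewrite -ge0_integral_fsum//.
- apply: eq_integral => x _; rewrite [in RHS]fimfunE -fsumEFin//.
  rewrite ge0_mule_fsuml; last by move=> r; rewrite nnfun_muleindic_ge0.
  by apply: eq_fsbigr => r _; rewrite EFinM muleA.
- move=> r; apply: emeasurable_funM => //.
  by apply: emeasurable_funM => //; exact/measurable_EFinP.
- move=> r x _; rewrite muleA; apply: mule_ge0; last by rewrite lee_fin.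
  exact: nnfun_muleindic_ge0.
Qed.

End Density.

(** * The moment problem on the unit interval *)

(** Induction: multiplying by 1 + h, which is nonnegative, leaves the slack n h^2. *)
Lemma bernoulli_ineq (R : realDomainType) (h : R) (n : nat) :
  -1 <= h -> 1 + n%:R * h <= (1 + h) ^+ n.
Proof.
move=> h1; elim: n => [|n IH]; first by rewrite mul0r addr0 expr0.
rewrite exprS (le_trans _ (ler_wpM2l _ IH))//; last by rewrite addrC -lerBlDr sub0r.
rewrite -natr1 -subr_ge0 [leRHS](_ : _ = n%:R * h ^+ 2); last by ring.
by rewrite mulr_ge0// sqr_ge0.
Qed.

(** With s the square root of r, n r^n = (n s^n) s^n, and Bernoulli for h = 1/s - 1 bounds n s^n by
    1/h. The case r = 0 is separate because s is inverted. *)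
Lemma cvg_natM_expr (R : realType) (r : R) : 0 <= r < 1 ->
  (fun n => n%:R * r ^+ n) @ \oo --> (0 : R).
Proof.
move=> /andP[]; rewrite le_eqVlt => /predU1P[<- _|r0 r1].
  apply: cvg_near_cst; near=> n; rewrite expr0n gtn_eqF ?mulr0//.
  by near: n; exists 1%N.
pose s := Num.sqrt r.
have s0 : 0 < s by rewrite sqrtr_gt0.
have s1 : s < 1 by rewrite -sqrtr1 ltr_sqrt.
have rE : r = s * s by rewrite -expr2 sqr_sqrtr// ltW.
pose h := s^-1 - 1.
have h0 : 0 < h by rewrite subr_gt0 invf_gt1.
apply: (@squeeze_cvgr _ _ _ _ (cst 0) (fun n => h^-1 * s ^+ n)).
- near=> n; rewrite /= mulr_ge0 ?exprn_ge0 ?(ltW r0)//=.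
  rewrite rE exprMn mulrA.
  rewrite ler_pM2r ?exprn_gt0//.
  rewrite -ler_pdivlMr ?exprn_gt0// -exprVn ler_pdivlMl// mulrC.
  have : -1 <= h by rewrite (le_trans _ (ltW h0))// lerN10.
  move=> /(bernoulli_ineq n); rewrite [1 + h]addrC subrK; apply: le_trans.
  by rewrite lerDr.
- exact: cvg_cst.
- by apply: cvg_geometric; rewrite ger0_norm// ltW.
Unshelve. all: by end_near. Qed.

(* The exponent N_n ~ n x^-n satisfies N_n t^n -> 0 for t < x, while
   N_n t^n >= n for x <= t. *)
Definition step_poly (R : realType) (x : R) (n : nat) : {poly R} :=
  (1 - 'X^n) ^+ (Num.trunc (n%:R / x ^+ n)).+1.

Lemma step_polyE (R : realType) (x t : R) (n : nat) :
  (step_poly x n).[t] = (1 - t ^+ n) ^+ (Num.trunc (n%:R / x ^+ n)).+1.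
Proof. by rewrite /step_poly !hornerE. Qed.

Lemma step_poly_itv01 (R : realType) (x t : R) (n : nat) : 0 <= t <= 1 ->
  0 <= (step_poly x n).[t] <= 1.
Proof.
move=> /andP[t0 t1]; rewrite step_polyE.
have tn1 : t ^+ n <= 1 by rewrite exprn_ile1.
by rewrite exprn_ge0 ?subr_ge0//= exprn_ile1 ?subr_ge0// gerBl exprn_ge0.
Qed.

Lemma cvg_step_poly (R : realType) (x t : R) : 0 < x <= 1 -> 0 <= t <= 1 ->
  (step_poly x n).[t] @[n --> \oo] --> (\1_`[0, x[ t : R).
Proof.
move=> /andP[x0 x1] /andP[t0 t1].
have tn0 n : 0 <= t ^+ n by rewrite exprn_ge0.
have tn1 n : t ^+ n <= 1 by rewrite exprn_ile1.
have xn0 n : 0 < x ^+ n by rewrite exprn_gt0.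
have nx0 n : 0 <= n%:R / x ^+ n by rewrite divr_ge0// ltW.
rewrite indicE; have [tx|xt] := ltP t x.
  rewrite mem_set/=; last by rewrite /= in_itv/= t0.
  (* The exponent N is at most n / x^n + 1, and Bernoulli bounds (1 - t^n)^N below by 1 - N t^n; the
     lone t^n pays for rounding n / x^n up to an integer. *)
  apply: (@squeeze_cvgr _ _ _ _
    (fun n => 1 - (n%:R * (t / x) ^+ n + t ^+ n)) (cst 1)).
  - near=> n; have /andP[_ ->] := @step_poly_itv01 _ x t n (introT andP (conj t0 t1)).
    rewrite andbT step_polyE.
    apply: le_trans (bernoulli_ineq _ _); last by rewrite lerN2.
    rewrite mulrN lerD2l lerN2 -natr1 mulrDl mul1r lerD2r expr_div_n.
    rewrite [leRHS]mulrCA [leRHS]mulrC ler_wpM2r//.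
    by have /andP[] := truncn_itv (nx0 n).
  - rewrite -[X in _ --> X]subr0; apply: cvgB; first exact: cvg_cst.
    rewrite -[X in _ --> X]addr0; apply: cvgD.
      by apply: cvg_natM_expr; rewrite divr_ge0 ?(ltW x0)//= ltr_pdivrMr// mul1r.
    by apply: cvg_expr; rewrite ger0_norm// (lt_le_trans tx).
  - exact: cvg_cst.
rewrite memNset/=; last by rewrite /= in_itv/= t0 ltNge xt.
apply: (@squeeze_cvgr _ _ _ _ (cst 0) (fun n => n.+1%:R^-1)).
- near=> n; have /andP[-> _] := @step_poly_itv01 _ x t n (introT andP (conj t0 t1)).
  rewrite /= step_polyE; set N := (Num.trunc _).+1.
  have nN : n%:R <= N%:R * t ^+ n.
    rewrite -ler_pdivrMr ?exprn_gt0 ?(lt_le_trans x0)//.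
    rewrite (le_trans _ (ltW (truncnS_gt _)))//.
    rewrite ler_wpM2l// lef_pV2 ?posrE ?exprn_gt0 ?(lt_le_trans x0)//.
    by rewrite lerXn2r ?nnegrE ?(ltW x0).
  (* Bernoulli bounds 1 + N t^n by (1 + t^n)^N, and the product of the two powers is (1 - t^(2n))^N
     <= 1. Since N t^n >= n, the polynomial is at most 1 / (n + 1). *)
  have : (1 - t ^+ n) ^+ N * (1 + N%:R * t ^+ n) <= 1.
    apply: (@le_trans _ _ ((1 - t ^+ n) ^+ N * (1 + t ^+ n) ^+ N)).
      rewrite ler_wpM2l ?exprn_ge0 ?subr_ge0// bernoulli_ineq//.
      by rewrite (le_trans _ (tn0 n))// lerN10.
    rewrite -exprMn -subr_sqr expr1n exprn_ile1//.
      by rewrite subr_ge0 exprn_ile1.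
    by rewrite gerBl sqr_ge0.
  rewrite -[_^-1]mul1r ler_pdivlMr//; apply: le_trans.
  by rewrite ler_wpM2l ?exprn_ge0 ?subr_ge0// -nat1r lerD2l.
- exact: cvg_cst.
- exact: cvg_harmonic.
Unshelve. all: by end_near. Qed.

(** * Recovering a measure from its moments *)

Section HausdorffMomentProblem.
Context {R : realType}.
Implicit Types (mu nu : borel_measure R) (p : {poly R}).
Local Open Scope ereal_scope.

Let I : set (measurableTypeR R) := `[0%R, 1%R]%classic.

Let mI : measurable I.
Proof. exact: measurable_itv. Qed.

Let mX (D : set (measurableTypeR R)) n :
  measurable_fun D (fun t : measurableTypeR R => ((t : R) ^+ n)%:E).
Proof. by apply/measurable_EFinP; exact: exprn_measurable. Qed.

Lemma moment_itv01 mu n : mu (~` `[0%R, 1%R]) = 0 ->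
  moment mu n = \int[mu]_(t in `[0%R, 1%R]) (t ^+ n)%:E.
Proof.
move=> mu0; rewrite /moment (@ge0_negligible_integral _ _ _ _ _ (~` I))//.
- rewrite setDE setCK; congr integral; apply/seteqP; split => [t []//|t It].
  by split => //; move: It; rewrite /I /= !in_itv/= => /andP[->].
- exact: measurableC.
- by move=> t; rewrite /= in_itv/= andbT lee_fin => t0; rewrite exprn_ge0.
Qed.

Lemma measure_itv01 mu : mu (~` `[0%R, 1%R]) = 0 ->
  mu `[0%R, 1%R]%classic = moment mu 0.
Proof.
move=> mu0; rewrite moment_itv01//.
by under eq_integral do rewrite expr0; rewrite integral_cst// mul1e.
Qed.

(** Finite total mass makes the monomials, bounded by 1 on [0, 1], integrable, so linearity applies:
    polynomial integrals see [mu] only through its moments. *)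
Lemma integral_poly_moment mu p : mu (~` `[0%R, 1%R]) = 0 -> moment mu 0 < +oo ->
  \int[mu]_(t in `[0%R, 1%R]) p.[t]%:E = \sum_(i < size p) (p`_i)%:E * moment mu i.
Proof.
move=> mu0 muoo.
have iX i : mu.-integrable I (fun t => (t ^+ i)%:E).
  apply: measurable_bounded_integrable => //.
  - by rewrite measure_itv01.
  - exists 1%R; split => // M M1 t; rewrite /I /= in_itv/= => /andP[t0 t1].
    by rewrite (le_trans _ (ltW M1))// ger0_norm ?exprn_ge0// exprn_ile1.
under eq_integral do rewrite horner_coef -sumEFin.
rewrite (@integral_sum _ _ _ mu I mI _ (fun (i : 'I_(size p)) t => (p`_i * t ^+ i)%:E)); last first.
  by move=> i; under eq_fun do rewrite EFinM; apply: integrableZl.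
apply: eq_bigr => i _; under eq_integral do rewrite EFinM.
by rewrite integralZl// moment_itv01.
Qed.

(** Dominated convergence, with the constant 1 as dominating function. *)
Lemma measure_itv0x_lim mu (x : R) : mu (~` `[0%R, 1%R]) = 0 ->
  moment mu 0 < +oo -> (0 < x <= 1)%R ->
  \int[mu]_(t in `[0%R, 1%R]) (step_poly x n).[t]%:E @[n --> \oo] -->
  mu `[0%R, x[%classic.
Proof.
move=> mu0 muoo x01; have /andP[_ x1] := x01.
have mp p : measurable_fun I (EFin \o (fun t => p.[t])).
  apply/measurable_EFinP; rewrite (funext (horner_coef p)).
  by apply: measurable_sum => i; exact: measurable_funM.
have [|||||_ _] := @dominated_convergence _ _ _ mu I mI
  (fun n t => (step_poly x n).[t]%:E) (fun t => (\1_`[0%R, x[ t)%:E) (cst 1).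
- by move=> n; exact: mp.
- by apply/measurable_EFinP; apply: measurable_indic; exact: measurable_itv.
- apply/aeW => t It; apply: cvg_EFin; first exact: nearW.
  by apply: cvg_step_poly => //; move: It; rewrite /I /= in_itv.
- apply: (@measurable_bounded_integrable _ _ _ _ (cst 1%R)) => //.
    by rewrite measure_itv01.
  by exists 1%R; split => // M M1 t It; rewrite /= normr1 ltW.
- apply/aeW => t n It; rewrite lee_fin.
  have /(@step_poly_itv01 _ x t n)/andP[p0 p1] : (0 <= t <= 1)%R.
    by move: It; rewrite /I /= in_itv.
  by rewrite ger0_norm.
rewrite integral_indic//=.
rewrite setIidl// => t; rewrite /I /= !in_itv/= => /andP[-> tx] /=.
exact: le_trans (ltW tx) x1.
Qed.

(** The open rays ]-oo, x[ are stable under intersection and generate the Borel sets, so it suffices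
    to compare the two measures on them. *)
Lemma eq_moment_same_measure mu nu :
  mu (~` `[0%R, 1%R]) = 0 -> nu (~` `[0%R, 1%R]) = 0 ->
  moment mu 0 < +oo -> (forall n, moment mu n = moment nu n) ->
  same_measure mu nu.
Proof.
move=> mu0 nu0 muoo mom.
have restrI (m : borel_measure R) A : m (~` `[0%R, 1%R]) = 0 -> measurable A ->
    m A = m (A `&` I).
  move=> m0 mA; rewrite -[in LHS](setIT A) -(setUv I) setIUr measureU0//.
  - exact: measurableI.
  - by apply: measurableI => //; exact: measurableC.
  - by apply: (@subset_measure0 _ _ _ _ _ (~` I)) => //;
      [apply: measurableI => //; exact: measurableC|exact: measurableC].
move=> A mA; apply: (@measure_unique _ R (measurableTypeR R) (@RGenInftyO.G R)
  (fun n => `]-oo, n%:R[%classic)).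
- exact: RGenInftyO.measurableE.
- move=> _ _ [x ->] [y ->]; exists (Num.min x y).
  by apply/seteqP; split => t /=; rewrite !in_itv/= lt_min; [case=> -> ->|case/andP].
- by move=> n; eexists.
- apply/seteqP; split => // t _; exists (Num.trunc t).+1 => //=.
  by rewrite in_itv/= truncnS_gt.
- move=> _ [x ->]; rewrite (restrI mu)// (restrI nu)//.
  (* The trace of the ray on [0, 1] is empty, equal to [0, x[, or all of [0, 1]; only the middle
     case needs the step polynomials. *)
  have [x0|x0] := leP x 0%R.
    rewrite (_ : _ `&` _ = set0) ?measure0//; apply/seteqP; split => // t [].
    by rewrite /I /= !in_itv/= => /lt_le_trans/(_ x0); case: ltP.
  have [x1|x1] := leP x 1%R.
    rewrite (_ : _ `&` _ = `[0%R, x[%classic); last first.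
      apply/seteqP; split => t; rewrite /I /= !in_itv/=.
        by move=> [-> /andP[->]].
      move=> /andP[t0 tx]; split; rewrite ?t0//=.
      exact: le_trans (ltW tx) x1.
    have x01 : (0 < x <= 1)%R by rewrite x0.
    have := measure_itv0x_lim mu0 muoo x01.
    (* Equal moments make the two approximating sequences coincide, hence also their limits. *)
    rewrite (_ : (fun n => _) = 
      fun n => \int[nu]_(t in `[0%R, 1%R]) (step_poly x n).[t]%:E); last first.
      apply/funext => n; rewrite !integral_poly_moment -?mom//.
      by apply: eq_bigr => i _; rewrite mom.
    move=> /cvg_unique; apply => //.
    by apply: measure_itv0x_lim => //; rewrite -mom.
  rewrite setIidr; last first.
    by move=> t; rewrite /I /= !in_itv/= => /andP[_ /le_lt_trans]; exact.
  by rewrite /I !measure_itv01.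
- move=> n; rewrite (le_lt_trans _ muoo)// -measure_itv01//.
  rewrite (restrI mu `]-oo, n%:R[%classic)//.
  by apply: le_measure; rewrite ?inE//; exact: measurableI.
- exact: mA.
Qed.

(** Bernoulli weakens (1 + h)^n to n h, so n h times the mass of [1 + h, +oo[ stays below [C] for
    all n and this mass is 0. Taking h = 1 / (k + 1), countably many such tails cover ]1, +oo[. *)
Lemma bounded_moments_supp mu (C : R) :
  mu `]-oo, 0%R[%classic = 0 -> (forall n, moment mu n <= C%:E) ->
  mu (~` `[0%R, 1%R]) = 0.
Proof.
move=> mu0 momC.
have tail (k : nat) : mu `[(1 + k.+1%:R^-1)%R, +oo[%classic = 0.
  set h : R := (k.+1%:R^-1)%R; have h0 : (0 < h)%R by rewrite invr_gt0.
  have ah : (0 <= 1 + h :> R)%R by rewrite addr_ge0// ltW.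
  have bnd n : ((n%:R * h)%:E * mu `[(1 + h)%R, +oo[%classic <= C%:E).
    apply: le_trans (momC n).
    apply: (@le_trans _ _ (\int[mu]_(t in `[(1 + h)%R, +oo[) (t ^+ n)%:E)).
      rewrite -integral_cst//.
      apply: ge0_le_integral => //.
      - by move=> t _; rewrite lee_fin mulr_ge0// ltW.
      - move=> t; rewrite /= in_itv/= andbT => ht; rewrite lee_fin.
        apply: (@le_trans _ _ ((1 + h) ^+ n)%R).
          have : (- 1 <= h)%R by rewrite (le_trans _ (ltW h0))// lerN10.
          by move=> /(bernoulli_ineq n); apply: le_trans; rewrite lerDr.
        by rewrite lerXn2r ?nnegrE// (le_trans ah).
    apply: ge0_subset_integral.
    - exact: measurable_itv.
    - exact: measurable_itv.
    - exact: mX.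
    - by move=> t; rewrite /= in_itv/= andbT lee_fin => t0; rewrite exprn_ge0.
    - by move=> t; rewrite /= !in_itv/= !andbT; exact: le_trans.
  set muh := mu _ in bnd *; have : 0 <= muh by exact: measure_ge0.
  (* Infinite mass is excluded by the bound at n = 1, a finite m > 0 by an n exceeding C / (h m). *)
  case: muh bnd => [m| |] bnd //; last first.
    by have := bnd 1%N; rewrite mul1r gt0_muley ?lte_fin// leye_eq.
  rewrite lee_fin le_eqVlt => /predU1P[<-//|m0].
  have hm0 : (0 < h * m)%R by rewrite mulr_gt0.
  have := bnd (Num.trunc (C / (h * m))%R).+1; rewrite -EFinM lee_fin -mulrA.
  by rewrite -ler_pdivlMr// leNgt truncnS_gt.
apply: (@subset_measure0 _ _ _ mu _
  (`]-oo, 0%R[ `|` \bigcup_k `[(1 + k.+1%:R^-1)%R, +oo[)%classic).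
- exact: measurableC.
- by apply: measurableU => //; exact: bigcupT_measurable.
- move=> t; rewrite /= !in_itv/= => /negP; rewrite negb_and -!ltNge => /orP[t0|t1].
    by left.
  right; exists (Num.trunc ((t - 1)^-1)%R) => //=; rewrite in_itv/= andbT.
  rewrite -lerBrDl invf_ple ?posrE ?subr_gt0//.
  by rewrite ltW// truncnS_gt.
- apply: null_set_setU => //; first exact: bigcupT_measurable.
  apply/eqP; rewrite eq_le measure_ge0 andbT.
  apply: (le_trans (measure_sigma_subadditive mu _ _ (@subset_refl _ _))) => //.
  - exact: bigcupT_measurable.
  - by rewrite eseries0// => k _ _; exact: tail.
Qed.

End HausdorffMomentProblem.

(** * The Gamma integral *)

Section GammaIntegral.
Context {R : realType}.
Implicit Types (q t : R).

Local Notation mu := (@lebesgue_measure R).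

Definition gamma_integrand q t : R := t `^ (q - 1) * expR (- t).

Lemma gamma_integrand_ge0 q t : 0 <= gamma_integrand q t.
Proof. by rewrite mulr_ge0 ?powR_ge0 ?expR_ge0. Qed.

Lemma measurable_gamma_integrand q D : measurable_fun D (gamma_integrand q).
Proof.
apply/measurable_funTS/measurable_funM; first exact: measurable_powR.
by apply: measurableT_comp; [exact: measurable_expR|exact: oppr_measurable].
Qed.

(** The shift to k + 2 gives 1 / (k + 2) < 1 < k + 2 already at k = 0, so that every interval is
    nondegenerate. *)
Lemma bigcup_itv_inv_nat :
  \bigcup_k `[(k.+2%:R^-1 : R), k.+2%:R]%classic = `]0, +oo[%classic.
Proof.
apply/seteqP; split => [t [k _]|t].
  by rewrite /= !in_itv/= andbT => /andP[+ _]; apply: lt_le_trans.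
rewrite /= in_itv/= andbT => t0.
exists (maxn (Num.trunc t) (Num.trunc t^-1)) => //=; rewrite in_itv/=.
set k := maxn _ _; apply/andP; split.
  rewrite invf_ple ?posrE// (le_trans (ltW (truncnS_gt _)))// ler_nat ltnS.
  by rewrite leqW// leq_maxr.
rewrite (le_trans (ltW (truncnS_gt _)))// ler_nat ltnS.
by rewrite leqW// leq_maxl.
Qed.

Lemma nondecreasing_itv_inv_nat :
  nondecreasing_seq (fun k => `[(k.+2%:R^-1 : R), k.+2%:R]%classic).
Proof.
move=> m n mn; apply/subsetPset => t; rewrite /= !in_itv/= => /andP[mt tm].
apply/andP; split.
  by rewrite (le_trans _ mt)// lef_pV2 ?posrE// ler_nat !ltnS.
by rewrite (le_trans tm)// ler_nat !ltnS.
Qed.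

(* Substituting (1 + t) / p in x <= e^x and taking the p-th power. *)
Lemma powR_le_expR (p t : R) : 0 < p -> 0 <= t ->
  (1 + t) `^ p <= p `^ p * expR 1 * expR t.
Proof.
move=> p0 t0; have t1 : 0 <= 1 + t by rewrite addr_ge0.
have -> : (1 + t) `^ p = p `^ p * ((1 + t) / p) `^ p.
  by rewrite -powRM ?divr_ge0 ?(ltW p0)// mulrC divfK ?gt_eqF.
rewrite -mulrA ler_wpM2l ?powR_ge0// -expRD.
have -> : expR (1 + t) = expR ((1 + t) / p) `^ p.
  by rewrite -expRM divfK ?gt_eqF.
rewrite ge0_ler_powR ?nnegrE ?expR_ge0 ?divr_ge0 ?(ltW p0)//.
by rewrite (le_trans _ (expR_ge1Dx _))// lerDr.
Qed.

(** Puts two-sided differentiability into the form required by the fundamental theorem of calculus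
    and by integration by substitution. *)
Lemma derivable_cc_LRcontinuous (F : R -> R) (a b : R) : a <= b ->
  (forall x, a <= x <= b -> derivable F x 1) -> derivable_oo_LRcontinuous F a b.
Proof.
move=> ab dF; have cF x : a <= x <= b -> {for x, continuous F}.
  by move=> /dF Fx; exact/differentiable_continuous/derivable1_diffP.
split.
- by move=> x; rewrite in_itv/= => /andP[ax xb]; apply: dF; rewrite !ltW.
- by apply: cvg_at_right_filter; apply: cF; rewrite lexx.
- by apply: cvg_at_left_filter; apply: cF; rewrite lexx andbT.
Qed.

Lemma continuous_powR_gt0 (p x : R) : 0 < x -> {for x, continuous (fun y : R => y `^ p)}.
Proof.
move=> x0; apply/differentiable_continuous/derivable1_diffP.
by have [] := is_derive1_powR p x0.
Qed.

(** The base is t / (1 + t), written so that its derivative (1 + t)^-2 is immediate. *)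
Lemma is_derive_ratio_powR q t : 0 < t ->
  is_derive t 1 (fun s => (1 - (1 + s)^-1) `^ q)
    (q * (1 - (1 + t)^-1) `^ (q - 1) * (1 + t) ^- 2).
Proof.
move=> t0; have t1 : 0 < 1 - (1 + t)^-1 by rewrite subr_gt0 invf_lt1 ?ltrDl ?addr_gt0.
have dV : is_derive t 1 (fun s : R => (1 + s)^-1) (- (1 + t) ^- 2).
  have nz : (fun s : R => 1 + s) t != 0 by rewrite gt_eqF// addr_gt0.
  have d0 : is_derive t 1 (fun s : R => 1 + s) 1.
    have h := is_deriveD (is_derive_cst (1 : R) t 1) (is_derive_id t 1).
    by apply: (is_derive_eq h); rewrite add0r.
  by apply: (is_derive_eq (is_deriveV nz d0)); rewrite /GRing.scale/= mulr1.
have d1 : is_derive t 1 (fun s : R => 1 - (1 + s)^-1) ((1 + t) ^- 2).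
  have h := is_deriveB (is_derive_cst (1 : R) t 1) dV.
  by apply: (is_derive_eq h); rewrite sub0r opprK.
have h := @is_derive1_comp R (fun y => y `^ q) (fun s => 1 - (1 + s)^-1) _ _ _
  (is_derive1_powR q t1) d1.
exact: h.
Qed.

(** The factor 1/q cancels the q produced by differentiating a q-th power; the rest is the constant
    of [powR_le_expR] at p = q + 1. *)
Let C q := q^-1 * ((q + 1) `^ (q + 1) * expR 1).

(* The bound is a multiple of the derivative of the bounded function
   (t / (1 + t))^q, which makes the Gamma integral finite at both ends. *)
Lemma gamma_integrand_le_derive q t : 0 < q -> 0 < t ->
  gamma_integrand q t <=
  C q * (q * (1 - (1 + t)^-1) `^ (q - 1) * (1 + t) ^- 2).
Proof.
move=> q0 t0; have t1 : 0 < 1 + t by rewrite addr_gt0.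
have q1 : 0 < q + 1 by rewrite addr_gt0.
have -> : 1 - (1 + t)^-1 = t / (1 + t).
  by field; rewrite gt_eqF.
(* Factoring out the derivative of the ratio leaves (1 + t)^(q + 1) e^-t, which [powR_le_expR]
   bounds. *)
have -> : gamma_integrand q t =
    (t / (1 + t)) `^ (q - 1) * (1 + t) ^- 2 * ((1 + t) `^ (q + 1) * expR (- t)).
  rewrite /gamma_integrand mulrA; congr (_ * _).
  rewrite -mulrA.
  have -> : (1 + t) ^- 2 * (1 + t) `^ (q + 1) = (1 + t) `^ (q - 1).
    have -> : q - 1 = (q + 1) - 2 by ring.
    rewrite powRB ?(gt_eqF t1) ?implybT// mulrC.
    by rewrite -[2 in RHS]/(2%:R) powR_mulrn ?(ltW t1).
  by rewrite -powRM ?divr_ge0 ?(ltW t0) ?(ltW t1)// divfK ?gt_eqF.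
have -> : C q * (q * (t / (1 + t)) `^ (q - 1) * (1 + t) ^- 2) =
    (t / (1 + t)) `^ (q - 1) * (1 + t) ^- 2 * ((q + 1) `^ (q + 1) * expR 1).
  by rewrite /C; field; rewrite !gt_eqF.
rewrite ler_wpM2l ?mulr_ge0 ?powR_ge0 ?invr_ge0 ?exprn_ge0 ?(ltW t1)//.
by rewrite expRN ler_pdivrMr ?expR_gt0// powR_le_expR// ltW.
Qed.

(** The majorant integrates to [C q] times an increment of (t / (1 + t))^q, a function with values
    in [0, 1]; hence a bound uniform in [a] and [b]. *)
Lemma integral_gamma_integrand_le q (a b : R) : 0 < q -> 0 < a -> a < b ->
  (\int[mu]_(t in `[a, b]) (gamma_integrand q t)%:E <= (C q)%:E)%E.
Proof.
move=> q0 a0 ab.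
have C0 : 0 <= C q by rewrite /C !mulr_ge0 ?invr_ge0 ?powR_ge0 ?expR_ge0 ?ltW.
pose f t := q * (1 - (1 + t)^-1) `^ (q - 1) * (1 + t) ^- 2.
have cf t : 0 < t -> {for t, continuous f}.
  move=> t0; have t1 : 0 < 1 + t by rewrite addr_gt0.
  have cV : {for t, continuous (fun s : R => (1 + s)^-1)}.
    apply: continuousV; first by rewrite gt_eqF.
    by apply: continuousD; [exact: cst_continuous|exact: cvg_id].
  have c1 : {for t, continuous (fun s : R => 1 - (1 + s)^-1)}.
    by apply: continuousB => //; exact: cst_continuous.
  apply: continuousM.
    apply: continuousM; first exact: cst_continuous.
    apply: (@continuous_comp _ _ _ (fun s : R => 1 - (1 + s)^-1) (fun y : R => y `^ (q - 1))) => //.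
    by apply: continuous_powR_gt0; rewrite subr_gt0 invf_lt1 ?ltrDl.
  rewrite (_ : (fun s : R => (1 + s) ^- 2) = fun s => (1 + s)^-1 * (1 + s)^-1).
    exact: continuousM.
  by apply/funext => s; rewrite -exprVn expr2.
have f0 t : 0 < t -> 0 <= f t.
  by move=> t0; rewrite /f !mulr_ge0 ?powR_ge0 ?(ltW q0)// invr_ge0 exprn_ge0// addr_ge0// ltW.
have cfab : {within `[a, b], continuous f}.
  apply: continuous_in_subspaceT => t; rewrite inE/= in_itv/= => /andP[at_ _].
  by apply: cf; exact: lt_le_trans at_.
have mf : measurable_fun `[a, b] f by exact: subspace_continuous_measurable_fun.
apply: (@le_trans _ _ (\int[mu]_(t in `[a, b]) ((C q)%:E * (f t)%:E))%E).
  apply: ge0_le_integral => //.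
  - by move=> t _; rewrite lee_fin gamma_integrand_ge0.
  - by apply/measurable_EFinP; exact: measurable_gamma_integrand.
  - by apply: emeasurable_funM => //; exact/measurable_EFinP.
  - move=> t; rewrite /= in_itv/= => /andP[at_ _]; rewrite -EFinM lee_fin.
    by apply: gamma_integrand_le_derive => //; exact: lt_le_trans at_.
rewrite ge0_integralZl//; last 2 first.
- exact/measurable_EFinP.
- by move=> t; rewrite /= in_itv/= => /andP[at_ _]; rewrite lee_fin f0// (lt_le_trans a0).
pose F t : R := (1 - (1 + t)^-1) `^ q.
have dF t : 0 < t -> is_derive t 1 F (f t) by exact: is_derive_ratio_powR.
rewrite (@continuous_FTC2 _ f F)//; last 2 first.
- apply: derivable_cc_LRcontinuous; first exact: ltW.
  by move=> t /andP[at_ _]; have [] := dF _ (lt_le_trans a0 at_).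
- move=> t; rewrite in_itv/= => /andP[at_ _].
  by rewrite derive1E; have [_ ->] := dF _ (lt_trans a0 at_).
rewrite -EFinB -EFinM lee_fin ler_piMr//.
rewrite lerBlDr (@le_trans _ _ 1)// ?lerDl ?powR_ge0//.
have b1 : 0 < 1 + b by rewrite addr_gt0// (lt_trans a0).
apply: (@le_trans _ _ (1 `^ q)); last by rewrite powR1.
rewrite ge0_ler_powR ?nnegrE ?(ltW q0)//.
  by rewrite subr_ge0 invf_le1// lerDl ltW// (lt_trans a0).
by rewrite gerBl invr_ge0 ltW.
Qed.

(** The point 0 is null, and the compact intervals exhaust the open half-line. *)
Lemma cvg_integral_itv0y (f : R -> R) : measurable_fun setT f ->
  (forall t, 0 <= f t) ->
  (\int[mu]_(t in `[k.+2%:R^-1%R, k.+2%:R%R]) (f t)%:E @[k --> \oo] -->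
   \int[mu]_(t in `[0%R, +oo[) (f t)%:E)%E.
Proof.
move=> mf f0; rewrite -integral_itv_obnd_cbnd; last first.
  by apply/measurable_EFinP; exact: measurable_funTS.
rewrite -bigcup_itv_inv_nat.
apply: (@ge0_nondecreasing_set_cvg_integral _ (measurableTypeR R) _
  (fun k => `[(k.+2%:R^-1 : R), k.+2%:R]%classic)).
- exact: nondecreasing_itv_inv_nat.
- by move=> k; exact: measurable_itv.
- by move=> k; apply/measurable_EFinP; exact: measurable_funTS.
- by move=> k t _; rewrite lee_fin.
Qed.

Lemma integral_gamma_integrand_lty q : 0 < q ->
  (\int[mu]_(t in `[0%R, +oo[) (gamma_integrand q t)%:E < +oo)%E.
Proof.
move=> q0; have cvgk := cvg_integral_itv0y (@measurable_gamma_integrand q setT)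
  (gamma_integrand_ge0 q).
apply: le_lt_trans (ltry (C q)); rewrite -(cvg_lim _ cvgk)//.
apply: lime_le; first exact: cvgP cvgk.
apply: nearW => k; apply: integral_gamma_integrand_le => //.
by rewrite (@lt_trans _ _ 1)// ?invf_lt1// ltr1n.
Qed.

(** [Gamma] is a real-valued integral, which would default to 0 if the extended one were infinite;
    finiteness identifies the two. *)
Lemma GammaE q : 0 < q ->
  (\int[mu]_(t in `[0%R, +oo[) (gamma_integrand q t)%:E = (Gamma q)%:E)%E.
Proof.
move=> q0; rewrite /Gamma /Rintegral fineK// ge0_fin_numE.
  exact: integral_gamma_integrand_lty.
by apply: integral_ge0 => t _; rewrite lee_fin gamma_integrand_ge0.
Qed.

(** On [1, 2] one has t^q >= 1 and 1/t >= 1/2, so the integrand is at least e^-2 / 2. *)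
Lemma Gamma_gt0 q : 0 < q -> 0 < Gamma q.
Proof.
move=> q0; rewrite -lte_fin -GammaE//.
apply: (@lt_le_trans _ _
  (\int[mu]_(t in `[1%R, 2%:R]) (2^-1 * expR (- 2))%:E)%E).
  rewrite integral_cst//= lebesgue_measure_itv/= lte_fin ltr1n/=.
  by rewrite -EFinB -EFinM lte_fin !mulr_gt0 ?expR_gt0// subr_gt0 ltr1n.
apply: (@le_trans _ _ (\int[mu]_(t in `[1%R, 2%:R]) (gamma_integrand q t)%:E)%E).
  apply: ge0_le_integral => //.
  - by apply/measurable_EFinP; exact: measurable_gamma_integrand.
  - move=> t; rewrite /= in_itv/= => /andP[t1 t2].
    have t0 : 0 < t by exact: lt_le_trans t1.
    rewrite lee_fin /gamma_integrand ler_pM ?invr_ge0 ?expR_ge0//; last first.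
      by rewrite ler_expR lerN2.
    rewrite powRB ?(gt_eqF t0) ?implybT// powRr1 ?(ltW t0)//.
    rewrite -[leLHS]mul1r ler_pM ?invr_ge0//; last by rewrite lef_pV2 ?posrE.
    by rewrite -[leLHS](powRr0 t) ler_powR// ltW.
apply: ge0_subset_integral => //.
- by apply/measurable_EFinP; exact: measurable_gamma_integrand.
- by move=> t _; rewrite lee_fin gamma_integrand_ge0.
- by move=> t; rewrite /= !in_itv/= andbT => /andP[t1 _]; exact: le_trans t1.
Qed.

(** Stated for 0 < a < b, which keeps u away from 0 and 1 and the integrand continuous; the full
    range is reached later by monotone limits. *)
Lemma integral_log_subst q n (a b : R) : 0 < a -> a < b ->
  (\int[mu]_(u in `[expR (- (b / n.+1%:R)), expR (- (a / n.+1%:R))])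
     (u ^+ n * (- ln u) `^ (q - 1))%:E =
   \int[mu]_(t in `[a, b]) (n.+1%:R^-1 `^ q * gamma_integrand q t)%:E)%E.
Proof.
move=> a0 ab; set c : R := n.+1%:R; have c0 : 0 < c by [].
pose F t : R := expR (- (t / c)).
have dF t : is_derive t 1 F (- (F t / c)).
  have d1 : is_derive t 1 (fun s : R => s * - c^-1) (- c^-1).
    have h := is_deriveM (is_derive_id t 1) (is_derive_cst (- c^-1 : R) t 1).
    by apply: (is_derive_eq h); rewrite scaler0 add0r /GRing.scale/= mulr1.
  have FE : F = expR \o (fun s : R => s * - c^-1).
    by apply/funext => s; rewrite /F /= mulrN.
  rewrite {1}FE; have h := @is_derive1_comp R expR (fun s : R => s * - c^-1) _ _ _
    (is_derive_expR _) d1.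
  by apply: (is_derive_eq h); rewrite /F !mulrN.
have F'E : derive1 F = (fun t => - (F t / c)).
  by apply/funext => t; rewrite derive1E; have [_ ->] := dF t.
have cF : continuous F.
  by move=> t; apply/differentiable_continuous/derivable1_diffP; have [] := dF t.
have cF' : continuous (derive1 F).
  by move=> t; rewrite F'E; apply: cvgN; apply: cvgM; [exact: cF|exact: cvg_cst].
rewrite -/(F a) -/(F b) (integration_by_substitution_decreasing (ltW ab)).
- apply: eq_integral => t; rewrite inE/= in_itv/= => /andP[at_ _].
  have t0 : 0 < t by exact: lt_le_trans at_.
  congr EFin; rewrite F'E !fctE/= opprK /F expRK opprK -expRM_natl.
  rewrite powRM ?invr_ge0 ?(ltW t0) ?(ltW c0)//.
  (* One factor 1/c comes from the derivative of the substitution, the remaining power from - ln u =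
     t / c. *)
  have -> : c^-1 `^ q = c^-1 * c^-1 `^ (q - 1).
    rewrite powRB ?invr_eq0 ?(gt_eqF c0) ?implybT// powRr1 ?invr_ge0 ?(ltW c0)//.
    by rewrite mulrC divfK// invr_eq0 gt_eqF.
  (* This is u^n times the further u contributed by the derivative. *)
  have e : expR (- t) = expR (n%:R * - (t / c)) * expR (- (t / c)).
    by rewrite -expRD -[X in _ + X]mul1r -mulrDl natr1 mulrN [_ * (t / c)]mulrC divfK// gt_eqF.
  by rewrite /gamma_integrand e; ring.
- by move=> x y _ _ xy; rewrite /F ltr_expR ltrN2 ltr_pM2r// invr_gt0.
- by move=> x _; exact: cF'.
- by apply: cvgP; apply: cvg_at_right_filter; exact: cF'.
- by apply: cvgP; apply: cvg_at_left_filter; exact: cF'.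
- by apply: derivable_cc_LRcontinuous => [|x _]; [exact: ltW|have [] := dF x].
- apply: continuous_in_subspaceT => u; rewrite inE/= in_itv/= => /andP[bu ua].
  have u0 : 0 < u by rewrite (lt_le_trans _ bu)// expR_gt0.
  have u1 : u < 1.
    by rewrite (le_lt_trans ua)// expR_lt1 oppr_lt0 divr_gt0.
  apply: cvgM; first exact: exprn_continuous.
  apply: (@continuous_comp _ _ _ (fun u : R => - ln u) (fun y : R => y `^ (q - 1))).
    by apply: continuousN; exact: continuous_ln.
  by apply: continuous_powR_gt0; rewrite oppr_gt0 ln_lt0// u0.
Qed.

(** The images [J k] of the intervals [1 / (k + 2), k + 2] exhaust ]0, 1[, so both sides are limits
    of the integrals matched by [integral_log_subst]. *)
Lemma integral_itv01_log q n : 0 < q ->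
  (\int[mu]_(u in `[0%R, 1%R]) (u ^+ n * (- ln u) `^ (q - 1))%:E =
   (n.+1%:R^-1 `^ q * Gamma q)%:E)%E.
Proof.
move=> q0; have c0 : (0 : R) < n.+1%:R by [].
set f := fun u : R => u ^+ n * (- ln u) `^ (q - 1).
have mf D : measurable_fun D f.
  apply/measurable_funTS/measurable_funM; first exact: exprn_measurable.
  apply: (measurableT_comp (measurable_powR _)).
  by apply: measurableT_comp; [exact: oppr_measurable|exact: measurable_ln].
pose J k : set (measurableTypeR R) :=
  `[expR (- (k.+2%:R / n.+1%:R) : R), expR (- (k.+2%:R^-1 / n.+1%:R))]%classic.
have bigJ : \bigcup_k J k = `]0, 1[%classic.
  apply/seteqP; split => [u [k _]|u]; rewrite /J /= !in_itv/= => /andP[].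
    move=> /(lt_le_trans (expR_gt0 _)) -> /le_lt_trans; apply.
    by rewrite expR_lt1 oppr_lt0 divr_gt0.
  move=> u0 u1; have : (\bigcup_k `[(k.+2%:R^-1 : R), k.+2%:R]%classic) (- ln u * n.+1%:R).
    by rewrite bigcup_itv_inv_nat /= in_itv/= andbT mulr_gt0// oppr_gt0 ln_lt0// u0.
  move=> [k _]; rewrite /= in_itv/= => /andP[k1 k2]; exists k => //=.
  rewrite in_itv/= -[u]lnK ?posrE// !ler_expR.
  by rewrite lerNl ler_pdivlMr// k2 lerNr ler_pdivrMr.
have ndJ : nondecreasing_seq J.
  move=> k m km; apply/subsetPset => u; rewrite /J /= !in_itv/= => /andP[k1 k2].
  apply/andP; split.
    by rewrite (le_trans _ k1)// ler_expR lerN2 ler_pM2r ?invr_gt0// ler_nat !ltnS.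
  rewrite (le_trans k2)// ler_expR lerN2 ler_pM2r ?invr_gt0//.
  by rewrite lef_pV2 ?posrE// ler_nat !ltnS.
have cvgf : (\int[mu]_(u in J k) (f u)%:E @[k --> \oo] -->
    \int[mu]_(u in `[0%R, 1%R]) (f u)%:E)%E.
  (* Drops the two null endpoints, where the value of [f] may rest on conventions. *)
  rewrite integral_itv_bndoo; last by apply/measurable_EFinP; exact: mf.
  rewrite -bigJ; apply: ge0_nondecreasing_set_cvg_integral => //.
  - by move=> k; exact: measurable_itv.
  - by move=> k; apply/measurable_EFinP; exact: mf.
  - move=> k u Ju; rewrite lee_fin mulr_ge0 ?powR_ge0// exprn_ge0//.
    have : (\bigcup_k J k) u by exists k.
    by rewrite bigJ /= in_itv/= => /andP[/ltW].
rewrite -(cvg_lim _ cvgf)//; apply/cvg_lim => //.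
pose g t := n.+1%:R^-1 `^ q * gamma_integrand q t.
rewrite (_ : (fun k => _) =
    (fun k => \int[mu]_(t in `[k.+2%:R^-1%R, k.+2%:R%R]) (g t)%:E)%E); last first.
  apply/funext => k; rewrite /J integral_log_subst//.
  by rewrite (@lt_trans _ _ 1)// ?invf_lt1// ltr1n.
rewrite EFinM -GammaE// -ge0_integralZl//; last 2 first.
- by apply/measurable_EFinP; exact: measurable_gamma_integrand.
- by move=> t _; rewrite lee_fin gamma_integrand_ge0.
apply: cvg_integral_itv0y.
- by apply: measurable_funM => //; exact: measurable_gamma_integrand.
- by move=> t; rewrite mulr_ge0 ?powR_ge0// gamma_integrand_ge0.
Qed.

End GammaIntegral.

(** * Moments of Lebesgue measure and of [log_measure] *)

Section Moments.
Context {R : realType}.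
Implicit Types (q : R) (n : nat).
Local Open Scope ereal_scope.

Local Notation mu := (@lebesgue_measure R).

(** The restriction to [0, 1] is absorbed into the density as an indicator, so that
    [ge0_integral_density] applies on all of [0, +oo[. *)
Lemma moment_density_itv01 (nu : borel_measure R) (g : R -> R) n :
  measurable_fun setT g -> (forall t, 0 <= g t)%R ->
  (forall A, measurable A -> nu A = \int[mu]_(t in A `&` `[0%R, 1%R]) (g t)%:E) ->
  moment nu n = \int[mu]_(t in `[0%R, 1%R]) (t ^+ n * g t)%:E.
Proof.
move=> mg g0 nuE.
pose I : set (measurableTypeR R) := `[0%R, 1%R]%classic.
have mI : measurable I by exact: measurable_itv.
have IE : `[0%R, +oo[%classic `&` I = I.
  by apply/setIidr => t; rewrite /I /= !in_itv/= => /andP[->].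
rewrite /moment (@ge0_integral_density _ (measurableTypeR R) R mu nu
  (g \* \1_I)%R); last 6 first.
- by apply: measurable_funM => //; exact: measurable_indic.
- by move=> t; rewrite /= mulr_ge0// indicE.
- move=> A mA; rewrite nuE// integral_mkcondr; apply: eq_integral => t _.
  by rewrite patchE/= indicE; case: ifPn => _; rewrite ?mulr1 ?mulr0.
- exact: measurable_itv.
- by apply/measurable_EFinP; exact: exprn_measurable.
- by move=> t; rewrite /= in_itv/= andbT => t0; rewrite lee_fin exprn_ge0.
rewrite -/I -{2}IE integral_mkcondr; apply: eq_integral => t _.
by rewrite patchE/= indicE -EFinM; case: ifPn => _; rewrite ?mulr1 ?mulr0.
Qed.

(** This is the case q = 1 of the logarithmic integral, where the power of the logarithm is
    constantly 1. Taking n = 0 first yields Gamma(1) = 1. *)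
Lemma moment_lebesgue01 n : moment (@lebesgue01 R) n = (n.+1%:R^-1)%:E.
Proof.
rewrite (@moment_density_itv01 _ (cst 1%R))//; last first.
  move=> A mA /=; rewrite integral_cst//= ?mul1e//.
  by apply: measurableI => //; exact: measurable_itv.
have powR0E (t : R) : ((- ln t) `^ (1 - 1) = 1)%R by rewrite subrr powRr0.
have Gamma1 : Gamma (1 : R) = 1%R.
  have := @integral_itv01_log R 1 0 ltr01.
  under eq_integral do rewrite expr0 mul1r powR0E.
  rewrite integral_cst//= lebesgue_measure_itv/= lte01 sube0 mule1.
  by rewrite invr1 powR1 mul1r => -[].
have := @integral_itv01_log R 1 n ltr01; under eq_integral do rewrite powR0E.
by rewrite Gamma1 mulr1 powRr1.
Qed.

Lemma moment_log_measure q n : (0 < q)%R ->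
  moment (log_measure q) n = (n.+1%:R^-1 `^ q)%:E.
Proof.
move=> q0; rewrite (@moment_density_itv01 _ (log_density q)) => //; last 2 first.
- exact: measurable_log_density.
- exact: log_density_ge0.
transitivity (\int[mu]_(t in `[0%R, 1%R])
    ((Gamma q)^-1%:E * (t ^+ n * (- ln t) `^ (q - 1))%:E)).
  by apply: eq_integral => t _; rewrite -EFinM /log_density mulrCA.
rewrite ge0_integralZl//; last 3 first.
- apply/measurable_EFinP/measurable_funTS/measurable_funM; first exact: exprn_measurable.
  apply: (measurableT_comp (measurable_powR _)).
  by apply: measurableT_comp; [exact: oppr_measurable|exact: measurable_ln].
- move=> t; rewrite /= in_itv/= => /andP[t0 _].
  by rewrite lee_fin mulr_ge0 ?powR_ge0// exprn_ge0.
- by rewrite lee_fin invr_ge0 ltW// Gamma_gt0.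
by rewrite integral_itv01_log// -EFinM mulrCA mulVf ?mulr1// gt_eqF// Gamma_gt0.
Qed.

End Moments.

(** * The power of Lebesgue measure and the weighted shift *)

Section LogMeasure.
Context {R : realType}.
Implicit Types (q : R) (nu : borel_measure R).
Local Open Scope ereal_scope.

Lemma log_measure_disjoint q (A : set (measurableTypeR R)) :
  A `&` `[0%R, 1%R] = set0 -> log_measure q A = 0.
Proof. by move=> A0; rewrite /log_measure A0 integral_set0. Qed.

(** Uniqueness for both formulations: the moments are at most 1, which confines [nu] to [0, 1]. The
    negative half-line is excluded by hypothesis, as [moment] integrates only over [0, +oo[. *)
Lemma same_measure_log_measure q nu : (0 < q)%R -> nu `]-oo, 0%R[%classic = 0 ->
  (forall n, moment nu n = (n.+1%:R^-1 `^ q)%:E) ->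
  same_measure nu (log_measure q).
Proof.
move=> q0 nu0 momnu; apply: eq_moment_same_measure.
- apply: (@bounded_moments_supp _ _ 1%R) => // n.
  rewrite momnu lee_fin -[leRHS](powRr0 (n.+1%:R^-1)) ger_powR ?(ltW q0)//.
  by rewrite invr_gt0 ltr0n/= invf_le1 ?ltr0n// ler1n.
- by apply: log_measure_disjoint; rewrite setICl.
- by rewrite momnu ltry.
- by move=> n; rewrite momnu moment_log_measure.
Qed.

Lemma compactly_supported_itv01 nu : nu (~` `[0%R, 1%R]) = 0 ->
  compactly_supported nu.
Proof.
move=> nu0; exists `[0%R, 1%R]%classic; split => //; first exact: segment_compact.
by move=> t; rewrite /= !in_itv/= => /andP[->].
Qed.

Lemma is_the_power_log_measure q : (0 < q)%R ->
  is_the_power q lebesgue01 (log_measure q).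
Proof.
move=> q0; split => [|nu [_ [K [cK K0 nuK]] momnu]].
  split=> [||n].
  - apply: compactly_supported_itv01.
    by rewrite /= /lebesgue01 /mrestr setICl measure0.
  - apply: compactly_supported_itv01.
    by apply: log_measure_disjoint; rewrite setICl.
  - by rewrite moment_log_measure// moment_lebesgue01.
apply: same_measure_log_measure => // [|n].
  (* Being compact, [K] is closed and so Borel; its null complement contains the negative
     half-line. *)
  have mK : measurable (K : set (measurableTypeR R)).
    by apply: closed_measurable; apply: compact_closed => //; exact: order_hausdorff.
  apply: (@subset_measure0 _ _ _ nu _ (~` K)) => //.
  - exact: measurableC.
  - by move=> t; rewrite /= in_itv/= => t0 /K0; rewrite /= in_itv/= andbT leNgt t0.
by rewrite momnu moment_lebesgue01.
Qed.

End LogMeasure.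

(** * Weights, norm and Berger measure of the shift *)

Section WeightedShiftNorm.
Context {R : realType}.
Implicit Types (alpha : nat -> R).
Local Open Scope ereal_scope.

Lemma l2norm_basis (c : R) (n : nat) :
  l2norm (fun k => (c%:C%C * (k == n)%:R)%R) = `|c|%:E.
Proof.
rewrite /l2norm Lnorm_counting//.
rewrite (@eq_eseriesr _ _ (fun k => if k == n then (`|c| ^+ 2)%:E else 0)%E);
  last first.
  move=> k _; case: eqP => _.
    rewrite mulr1 normc_def/= expr0n/= addr0 sqrtr_sqr normr_id.
    by rewrite powR_mulrn.
  by rewrite mulr0 normr0/= normr0 powR0.
rewrite (@nneseriesD1 _ _ n)//=; last first.
  by move=> k _; case: ifP => // _; rewrite lee_fin sqr_ge0.
rewrite eqxx eseries0 ?adde0; last by move=> k _ /negbTE ->.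
by rewrite poweR_EFin -powR_mulrn// -powRrM divff// powRr1.
Qed.

(** Tests the supremum on the unit vector e_n, sent to alpha_n e_(n+1). *)
Lemma le_shift_norm alpha n : `|alpha n|%:E <= shift_norm alpha.
Proof.
apply: ereal_sup_ubound; exists (fun k => (k == n)%:R%R).
  have := l2norm_basis 1 n; rewrite normr1.
  by under eq_fun do rewrite mul1r; rewrite /= => ->.
by rewrite weighted_shift_basis l2norm_basis.
Qed.

Lemma shift_momentS alpha n :
  shift_moment alpha n.+1 = (shift_moment alpha n * alpha n ^+ 2)%R.
Proof. by rewrite /shift_moment big_nat_recr. Qed.

Let ratio n : R := (n.+1%:R / n.+2%:R)%R.

Let ratio_gt0 n : (0 < ratio n)%R.
Proof. by rewrite divr_gt0. Qed.

Let powR_invS (q : R) n :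
  (n.+2%:R^-1 `^ q = n.+1%:R^-1 `^ q * ratio n `^ q)%R.
Proof.
rewrite -powRM ?invr_ge0 ?(ltW (ratio_gt0 n))//.
by congr (_ `^ _)%R; rewrite /ratio mulrA mulVf ?mul1r.
Qed.

Lemma shift_moment_powR_sqr (q : R) alpha :
  (forall n, shift_moment alpha n = n.+1%:R^-1 `^ q)%R ->
  forall n, (alpha n ^+ 2 = ratio n `^ q)%R.
Proof.
move=> mom n; have := mom n.+1; rewrite shift_momentS mom powR_invS.
by apply: mulfI; rewrite gt_eqF// powR_gt0 ?invr_gt0.
Qed.

(** Quotients of successive moments fix the squared weights, and positivity selects the root. *)
Lemma exists_unique_weights (q : R) : (0 < q)%R ->
  exists! alpha : nat -> R, is_weight_sequence alpha /\
    forall n : nat, shift_moment alpha n = (n.+1%:R^-1 `^ q)%R.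
Proof.
move=> q0; pose alpha n := Num.sqrt (ratio n `^ q)%R.
have alpha2 n : (alpha n ^+ 2 = ratio n `^ q)%R by rewrite sqr_sqrtr ?powR_ge0.
have alpha0 n : (0 < alpha n)%R by rewrite sqrtr_gt0 powR_gt0.
exists alpha; split; [split; [split=> //|]|].
- exists 1%R => n; rewrite -[leRHS]sqrtr1 ler_wsqrtr// -[leRHS](powRr0 (ratio n)).
  rewrite ger_powR ?(ltW q0)// ratio_gt0/=.
  by rewrite /ratio ler_pdivrMr// mul1r ler_nat.
- elim=> [|n IH]; last by rewrite shift_momentS IH alpha2 powR_invS.
  by rewrite /shift_moment big_nil invr1 powR1.
- move=> beta [[beta0 _] mom]; apply/funext => n.
  apply/eqP; rewrite -(@eqrXn2 _ 2)// ?ltW//; apply/eqP.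
  by rewrite alpha2 (shift_moment_powR_sqr mom).
Qed.

(** Every weight is below 1, so the bound appears only in the limit of the squared weights. *)
Lemma shift_norm_sqr_ge1 (q : R) alpha : (0 < q)%R ->
  (forall n, shift_moment alpha n = n.+1%:R^-1 `^ q)%R ->
  1 <= shift_norm alpha ^+ 2.
Proof.
move=> q0 mom.
have ge n : (ratio n `^ q)%:E <= shift_norm alpha ^+ 2.
  rewrite -(shift_moment_powR_sqr mom) -real_normK ?num_real// expr2 EFinM expe2.
  by apply: lee_pmul => //; exact: le_shift_norm.
have cvgr : (fun n => ratio n) @ \oo --> (1 : R)%R.
  rewrite (_ : (fun n => _) = (fun n => 1 - n.+2%:R^-1)%R).
    rewrite -[X in _ --> X]subr0; apply: cvgB; first exact: cvg_cst.
    have h := @cvg_harmonic R; rewrite -cvg_shiftS in h.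
    exact: h.
  apply/funext => n; rewrite /ratio -(natr1 n.+1).
  by field; rewrite nat1r natr1 pnatr_eq0.
have cvgq : (fun n => (ratio n `^ q)%:E) @ \oo --> (1 : \bar R).
  apply: cvg_EFin; first exact: nearW.
  have h : (fun n => ratio n `^ q)%R @ \oo --> (1 `^ q : R)%R.
    exact: (cvg_comp _ _ cvgr (@continuous_powR_gt0 R q 1 ltr01)).
  by rewrite powR1 in h; exact: h.
rewrite -(cvg_lim _ cvgq)//; apply: lime_le; first exact: cvgP cvgq.
exact: nearW.
Qed.

Lemma is_the_Berger_log_measure (q : R) alpha : (0 < q)%R ->
  (forall n, shift_moment alpha n = n.+1%:R^-1 `^ q)%R ->
  is_the_Berger alpha (log_measure q).
Proof.
move=> q0 mom; have N1 := shift_norm_sqr_ge1 q0 mom.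
split; [split|move=> nu [_ nuN momnu]].
- transitivity (moment (log_measure q) 0); last first.
    by rewrite moment_log_measure// invr1 powR1.
  rewrite -measure_itv01; last by apply: log_measure_disjoint; rewrite setICl.
  by rewrite /= /log_measure setTI setIid.
- apply: log_measure_disjoint; apply/seteqP; split => // t [] + t01; apply.
  move: t01; rewrite /= in_itv/= => /andP[t0 t1]; rewrite lee_fin t0/=.
  by rewrite (le_trans _ N1)// lee_fin.
- by move=> n; rewrite mom moment_log_measure.
apply: same_measure_log_measure => // [|n]; last by rewrite -momnu mom.
(* As an extended real the norm could be infinite, so the set is either [0, r] or [0, +oo[. *)
have mN : measurable ([set t | 0 <= t%:E <= shift_norm alpha ^+ 2] : set (measurableTypeR R)).
  case: (shift_norm alpha ^+ 2) N1 => [r| |]// _.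
    rewrite (_ : [set _ | _] = `[0%R, r]%classic); first exact: measurable_itv.
    by apply/seteqP; split => t; rewrite /= in_itv/= !lee_fin.
  rewrite (_ : [set _ | _] = `[0%R, +oo[%classic); first exact: measurable_itv.
  by apply/seteqP; split => t; rewrite /= in_itv/= lee_fin leey.
apply: (@subset_measure0 _ _ _ nu _ (~` [set t | 0 <= t%:E <= shift_norm alpha ^+ 2])) => //.
- exact: measurableC.
- by move=> t; rewrite /= in_itv/= => t0 /andP[]; rewrite lee_fin leNgt t0.
Qed.

End WeightedShiftNorm.

Theorem theorem4p3 (R : realType) (q : R) (hq : 0 < q) :
  is_the_power q lebesgue01 (log_measure q)
  /\
  (exists! alpha : nat -> R, is_weight_sequence alpha /\
     forall n : nat, shift_moment alpha n = (n.+1%:R^-1) `^ q)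
  /\
  (forall alpha : nat -> R, is_weight_sequence alpha ->
     (forall n : nat, shift_moment alpha n = (n.+1%:R^-1) `^ q) ->
     is_the_Berger alpha (log_measure q)).
Proof.
split; first exact: is_the_power_log_measure.
split; first exact: exists_unique_weights.
by move=> alpha _ mom; exact: is_the_Berger_log_measure.
Qed.
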